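(* Let $\Gamma$ be a discrete group and $\Delta\subseteq\Gamma$ a positivity domain. The pair $(\mathrm{B}(\Delta),(\mathrm{B}(\Delta,\mathbb{C}^n)^+)_{n})$ is the matrix ordered vector space dual of the operator system $\mathrm{UOS}(\Delta)$, where $u\in \mathrm{B}(\Delta,\mathbb{C}^n)$ is identified with the linear map $\mathrm{UOS}(\Delta)\to \mathrm{M}_n$, $\delta_s\mapsto u(s)$.
   Context: $\mathrm{M}_n=\mathrm{M}_n(\mathbb{C})$. A positivity domain is a subset $\Delta\subseteq\Gamma$ with $e\in\Delta$ and $\Delta^{-1}=\Delta$. $\mathrm{C}^*(\Gamma)$ is the universal group C$^*$-algebra with canonical unitaries $\delta_s$. For a Hilbert space $H$, $u:\Delta\to\mathcal{B}(H)$ is positive semi-definite if $(u(st^{-1}))_{s,t\in\Sigma}$ is a positive operator on $\ell^2(\Sigma)\otimes H$ for every finite $\Sigma\subseteq\Gamma$ with $\Sigma\Sigma^{-1}\subseteq\Delta$. $\mathrm{B}(\Delta,H)^+$ is the cone of such functions, $\mathrm{B}(\Delta,H)$ its linear span, and $\mathrm{B}(\Delta)=\mathrm{B}(\Delta,\mathbb{C})$. $\mathrm{UOS}(\Delta)$ is the operator system with underlying $*$-vector space $\mathrm{S}[\Delta]=\mathrm{span}\{\delta_s\mid s\in\Delta\}$, $\delta_s^*=\delta_{s^{-1}}$, Archimedean matrix order unit $\delta_e$, and $n$-th positive cone $\{x\in \mathrm{M}_n(\mathrm{S}[\Delta])_{\mathrm h}\mid x+r\,\mathbf 1_n\otimes\delta_e\in\mathcal{U}_n(\Delta)\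 \forall r>0\}$, where $\mathcal{U}_n(\Delta)$ is the convex cone generated by $\bigcup\{\mathcal{Q}_n(\Sigma)\mid\Sigma\subseteq\Gamma\text{ finite},\ \Sigma\Sigma^{-1}\subseteq\Delta\}$ and $\mathcal{Q}_n(\Sigma)=\{\sum_{i=1}^r y_iy_i^*\mid r\in\mathbb{N},\ y_i=\sum_{s\in\Sigma}A^i_s\otimes\delta_s,\ A^i_s\in \mathrm{M}_n\}$. The matrix ordered vector space dual $X^{\mathrm d}$ of an operator system $X$ is the complex linear span of the positive linear functionals on $X$, with positive cones $\mathrm{M}_n(X^{\mathrm d})^+:=\mathcal{CP}(X,\mathrm{M}_n)$, the completely positive maps $X\to \mathrm{M}_n$ (a matrix $(f_{ij})$ of functionals being viewed as the map $x\mapsto(f_{ij}(x))$). *)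

(* Defs.v *)
From HB Require Import structures.
From mathcomp Require Import all_boot all_order all_algebra.
From mathcomp Require Import finmap complex.
From mathcomp Require Import all_classical all_reals all_analysis.

Set Implicit Arguments.
Unset Strict Implicit.
Unset Printing Implicit Defensive.

Import Order.TTheory GRing.Theory Num.Theory.
Import numFieldNormedType.Exports.

Local Open Scope classical_set_scope.
Local Open Scope ring_scope.

Section LinSpan.
Variables (K : pzRingType) (V : lmodType K) (S : set V).

Definition lin_span : set V :=
  [set v | exists (n : nat) (c : 'I_n -> K) (x : 'I_n -> V),
     (forall i, S (x i)) /\ v = \sum_i c i *: x i].

Lemma sub_lin_span v : S v -> v \in lin_span.
Proof.
move=> Sv; rewrite inE; exists 1%N, (fun=> 1), (fun=> v); split => //.
by rewrite big_ord1 scale1r.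
Qed.

Lemma lin_span_submod : submod_closed (mem lin_span).
Proof.
split; first by rewrite inE; exists 0%N, (fun=> 0), (fun=> 0); split;
  [case | rewrite big_ord0].
move=> a u v; rewrite !inE => -[n [c [x [Sx ->]]]] [m [d [y [Sy ->]]]].
exists (n + m)%N,
  (fun i => match fintype.split i with inl j => a * c j | inr k => d k end),
  (fun i => match fintype.split i with inl j => x j | inr k => y k end); split.
  by move=> i; case: splitP.
rewrite big_split_ord /= scaler_sumr; congr (_ + _); apply: eq_bigr => i _.
  by rewrite (unsplitK (inl i)) scalerA.
by rewrite (unsplitK (inr i)).
Qed.

HB.instance Definition _ :=
  GRing.isSubmodClosed.Build K V (mem lin_span) lin_span_submod.

Record span_type := Span { span_val : V; _ : mem lin_span span_val }.

HB.instance Definition _ := [isSub for span_val].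
HB.instance Definition _ := [Choice of span_type by <:].
HB.instance Definition _ := [SubChoice_isSubLmodule of span_type by <:].

End LinSpan.

(* Unital complex C*-algebras. As for the norms of the library, [cnorm a] lies
   in R[i]; it is real and nonnegative by [cnormD] and [cnormZ]. The norm is a
   field because the hierarchy admits no join of algebras and normed modules. *)
Record cstarAlg (R : realType) := CstarAlg {
  cstar_sort :> algType R[i];
  cadj : cstar_sort -> cstar_sort;
  cnorm : cstar_sort -> R[i];
  cadjD : forall a b, cadj (a + b) = cadj a + cadj b;
  cadjZ : forall (c : R[i]) a, cadj (c *: a) = c^* *: cadj a;
  cadjM : forall a b, cadj (a * b) = cadj b * cadj a;
  cadjK : involutive cadj;
  cnormD : forall a b, cnorm (a + b) <= cnorm a + cnorm b;
  cnormZ : forall (c : R[i]) a, cnorm (c *: a) = `|c| * cnorm a;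
  cnorm_eq0 : forall a, cnorm a = 0 -> a = 0;
  cnormM : forall a b, cnorm (a * b) <= cnorm a * cnorm b;
  cnorm_adjM : forall a, cnorm (cadj a * a) = cnorm a ^+ 2;
  cnorm_complete : forall u : nat -> cstar_sort,
    (forall e : R[i], 0 < e -> exists N, forall m n : nat,
       (N <= m)%N -> (N <= n)%N -> cnorm (u m - u n) < e) ->
    exists l, forall e : R[i], 0 < e -> exists N, forall n : nat,
       (N <= n)%N -> cnorm (u n - l) < e }.

Arguments cadj {R c0}.
Arguments cnorm {R c0}.

Section GroupCstar.
Variables (R : realType) (G : groupType).
Local Notation C := R[i].

(* The complete norm of [H] is the one induced by the inner product [ip], so that
   [H] is a Hilbert space *)
Definition hilbert_norm (H : completeNormedModType C)
    (ip : {dot H for (@Num.conj C)}) : Prop :=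
  forall x : H, `|x| ^+ 2 = ip x x.

Definition unitary_rep (H : completeNormedModType C)
    (ip : {dot H for (@Num.conj C)}) (pi : G -> {linear H -> H}) : Prop :=
  [/\ forall s x y, ip (pi s x) (pi s y) = ip x y,
      forall x, pi 1%g x = x
    & forall s t x, pi (s * t)%g x = pi s (pi t x)].

Definition star_rep (A : cstarAlg R) (H : completeNormedModType C)
    (ip : {dot H for (@Num.conj C)}) (rho : A -> {linear H -> H}) : Prop :=
  [/\ forall a, continuous (rho a : H -> H),
      forall (c : C) a b x, rho (c *: a + b) x = c *: rho a x + rho b x,
      forall x, rho 1 x = x,
      forall a b x, rho (a * b) x = rho a (rho b x)
    & forall a x y, ip (rho a x) y = ip x (rho (cadj a) y)].

(* [A] with the unitaries [delta s] is the universal group C*-algebra of [G]: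
   it is generated by them, and every unitary representation of [G] on a
   Hilbert space extends to a *-representation of [A]. *)
Record is_group_cstar (A : cstarAlg R) (delta : G -> A) : Prop := {
  group_cstar1 : delta 1%g = 1;
  group_cstarM : forall s t, delta (s * t)%g = delta s * delta t;
  group_cstar_unitary : forall s,
    cadj (delta s) * delta s = 1 /\ delta s * cadj (delta s) = 1;
  group_cstar_dense : forall a (e : C), 0 < e ->
    exists2 b, lin_span (range delta) b & cnorm (a - b) < e;
  group_cstar_universal :
    forall (H : completeNormedModType C) (ip : {dot H for (@Num.conj C)})
      (pi : G -> {linear H -> H}),
      hilbert_norm ip -> unitary_rep ip pi ->
    exists rho : A -> {linear H -> H},
      star_rep ip rho /\ forall s x, rho (delta s) x = pi s x }.

End GroupCstar.

Section MatrixOrder.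
Variable (R : realType).
Local Notation C := R[i].

(* The operator [(T i j)] on l^2(I) (x) C^n is positive; in particular this is
   positivity in M_m(M_n) for [I := 'I_m]. Note that [0 <= z] in R[i] means
   that z is real and nonnegative. *)
Definition block_psd (I : finType) n (T : I -> I -> 'M[C]_n) : Prop :=
  forall xi : I -> 'cV[C]_n,
    0 <= (\sum_i \sum_j map_mx Num.conj (xi i)^T *m T i j *m xi j) 0 0.

(* The data of a matrix ordered vector space *)
Record mo_space := MoSpace {
  mo_carrier :> lmodType C;
  mo_cone : forall n, set 'M[mo_carrier]_n }.

(* The matrix-valued function given by a matrix of scalar functions *)
Definition mxfun (T : Type) (S : set (T -> C^o)) n
    (F : 'M[span_type S]_n) : T -> 'M[C]_n :=
  fun t => \matrix_(i, j) span_val (F i j) t.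

Definition completely_positive (X : mo_space) n : set (X -> 'M[C]_n) :=
  [set phi | linear phi /\
    forall m (x : 'M[X]_m), mo_cone x -> block_psd (fun i j => phi (x i j))].

Definition positive_functional (X : mo_space) : set (X -> C^o) :=
  [set f | linear f /\
    forall x : X, mo_cone (const_mx x : 'M[X]_1) -> 0 <= (f x : C)].

Definition mo_dual (X : mo_space) : mo_space :=
  @MoSpace (span_type (@positive_functional X))
    (fun n => [set F | @completely_positive X n (mxfun F)]).

End MatrixOrder.

Section PositivityDomain.
Variables (R : realType) (G : groupType).
Local Notation C := R[i].

Definition positivity_domain (D : set G) : Prop :=
  D 1%g /\ [set s^-1%g | s in D] = D.

Variable D : set G.

Definition admissible (E : {fset G}) : Prop :=
  forall s t, s \in E -> t \in E -> D (s * t^-1)%g.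

Definition zero_ext n (u : D -> 'M[C]_n) (g : G) : 'M[C]_n :=
  oapp u 0 (insub g).

(* B(D, C^n)^+; when [E] is admissible [zero_ext u] is only evaluated in [D] *)
Definition Bpos n : set (D -> 'M[C]_n) :=
  [set u | forall E : {fset G}, admissible E ->
    block_psd (fun s t : E => zero_ext u (val s * (val t)^-1)%g)].

Definition Bvec n : set (D -> 'M[C]_n) := lin_span (@Bpos n).

Definition Bpos_scalar : set (D -> C^o) :=
  [set u | @Bpos 1 (fun s => const_mx (u s))].

Definition Bspace : mo_space R :=
  @MoSpace R (span_type Bpos_scalar) (fun n => [set U | Bpos (mxfun U)]).

Variables (A : cstarAlg R) (delta : G -> A).

Definition adjmx n (y : 'M[A]_n) : 'M[A]_n := map_mx cadj y^T.

(* a (x) b in M_n (x) A = M_n(A) *)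
Definition tensmx n (a : 'M[C]_n) (b : A) : 'M[A]_n :=
  map_mx (fun c => c *: b) a.

Definition Qcone n (E : {fset G}) : set 'M[A]_n :=
  [set z | exists r (a : 'I_r -> G -> 'M[C]_n),
    z = \sum_(i < r) (let y := \sum_(s <- E) tensmx (a i s) (delta s) in
                      y *m adjmx y)].

(* The convex cone generated by the [Qcone n E], [E] admissible *)
Definition Ucone n : set 'M[A]_n :=
  [set z | exists m (c : 'I_m -> C) (x : 'I_m -> 'M[A]_n),
    [/\ forall i, 0 <= c i,
        forall i, exists2 E : {fset G}, admissible E & Qcone E (x i)
      & z = \sum_i map_mx ( *:%R (c i)) (x i)]].

Definition UOS_carrier := span_type (delta @` D).

Definition UOS_cone n : set 'M[UOS_carrier]_n :=
  [set x | let x' := map_mx (@span_val _ _ _) x in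
    adjmx x' = x' /\
    forall r : C, 0 < r -> Ucone (x' + tensmx r%:M (delta 1%g))].

Definition UOS : mo_space R := @MoSpace R UOS_carrier UOS_cone.

Lemma UOS_delta_subproof (s : D) : (delta @` D) (delta (val s)).
Proof. by exists (val s) => //; rewrite -inE; exact: valP. Qed.

Definition UOS_delta (s : D) : UOS := Span (sub_lin_span (UOS_delta_subproof s)).

End PositivityDomain.

(* Main.v *)
Require Import Defs.
From HB Require Import structures.
From mathcomp Require Import all_boot all_order all_algebra.
From mathcomp Require Import finmap complex.
From mathcomp Require Import all_classical all_reals all_analysis.
From mathcomp Require Import showcase.summability.
From mathcomp Require Import ring.

Set Implicit Arguments.
Unset Strict Implicit.
Unset Printing Implicit Defensive.

Import Order.TTheory GRing.Theory Num.Theory.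
Import numFieldNormedType.Exports.

Local Open Scope classical_set_scope.
Local Open Scope ring_scope.

(** A linear map on the operator system is determined by its values at the
unitaries delta_s, s in D. The content of the theorem is that every function
u on D extends to a linear map delta_s |-> u s, and that complete positivity of
this extension is positive semi-definiteness of u.

The extension exists because the delta_s are linearly independent in the group
C*-algebra. By universality the left regular representation of G on l^2(G)
extends to a representation rho of the algebra, and the coordinate at g of
[rho a e_1] is a linear functional of a that sends delta_s to 1 if s = g and to
0 otherwise ([delta_coef]). This requires l^2(G) as a Hilbert space for an
arbitrary discrete group G: [l2_complete] is its completeness. The extension of
u is [delta_ext].

The two notions of positivity meet in the squares y y^*, where
y = sum_(s in E) a_s (x) delta_s. If phi is linear on the operator system, with
u s = phi (delta_s), then [hform_square] says that the Hermitian form of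
phi (y y^* ) at xi is
  sum_k sum_(s, t in E) (eta_s^k)^* u (s t^-1) eta_t^k,
where eta_s^k = sum_i conj ((a_s)_ik) xi_i. If u is positive semi-definite,
then all these sums are nonnegative; since the cones of the operator system are
the Archimedean closures of the cones generated by the squares, phi is
completely positive ([Bpos_cp]). Conversely the a_s can be chosen so that the
eta_s^k are arbitrary vectors for one k and vanish for the others ([cp_Bpos]).
Scalar a_s suffice for a functional ([positive_functional_Bpos]), so positivity
of a functional, which involves only the first cone, already yields a positive
semi-definite function.

It remains to compare the matrices over B(D) with B(D, C^n). Polarization
writes an entry of a positive semi-definite matrix-valued function u as a
combination of the scalar functions v^* u v ([Bvec_coord]), and f E_pq as a
combination of the functions f v v^* ([Bvec_entry]); both v^* u v and f v v^*
are positive semi-definite. *)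

#[local] Existing Instance totally_filter.

(** * Cauchy-Schwarz and polarization *)

Section Dot.
Variables (C : numClosedFieldType) (U : lmodType C).
Variable form : {dot U for (@Num.conj C)}.

(** Stated for spaces of any dimension: u is decomposed into its orthogonal
projection to the line of v and a remainder w, whose square norm is dropped. *)
Lemma dot_CauchySchwarz (u v : U) : `|form u v| ^+ 2 <= form u u * form v v.
Proof.
have [->|nz_v] := eqVneq v 0.
  by rewrite [form u 0]linear0r [form 0 0]linear0r normr0 expr0n mulr0.
have v_gt0 : 0 < form v v by rewrite dnorm_gt0.
pose a := form u v / form v v; pose w := u - a *: v.
have wv0 : form w v = 0.
  by rewrite linearBl /= linearZl_LR /= divfK ?subrr // gt_eqF.
have -> : form u u = form w w + `|a| ^+ 2 * form v v.
  by rewrite -dnormZ -hnormDd ?subrK //= linearZr_LR /= wv0 mulr0.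
have -> : form u v = a * form v v by rewrite divfK // gt_eqF.
rewrite mulrDl normrM exprMn (ger0_norm (ltW v_gt0)) [form v v ^+ 2]expr2 mulrA lerDr.
by rewrite mulr_ge0 ?dnorm_ge0.
Qed.

Lemma dot_triangle (u v : U) :
  sqrtC (form (u + v) (u + v)) <= sqrtC (form u u) + sqrtC (form v v).
Proof.
have s_ge0 (x : U) : 0 <= sqrtC (form x x) := sqrt_dnorm_ge0 form x.
rewrite -ler_sqr ?nnegrE ?addr_ge0 //.
rewrite sqrrD !sqrtCK dnormD /= [leRHS]addrAC lerD2l -mulr_natr.
rewrite -[X in X <= _](divfK (negbT (pnatr_eq0 C 2))) ler_pM2r ?ltr0n //.
apply: (@le_trans _ _ `|form u v|).
  by rewrite -ReE; case: (leif_Re_Creal (form u v)).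
rewrite -ler_sqr ?nnegrE ?mulr_ge0 // exprMn !sqrtCK.
exact: dot_CauchySchwarz.
Qed.
End Dot.

(** The terms B(x, x), B(y, y) and B(y, x) of the expansion carry the factors
i^k, i^k and i^(2k), whose sums over k < 4 vanish; the factor of B(x, y) is
constantly 1/4. *)
Lemma polarization (C : numClosedFieldType) (U V : lmodType C)
    (B : U -> U -> V)
    (Bl : forall a x x' y, B (a *: x + x') y = a *: B x y + B x' y)
    (Br : forall a x y y', B x (a *: y + y') = a^* *: B x y + B x y') x y :
  B x y = \sum_(k < 4)
    (4^-1 * 'i ^+ k) *: B (x + 'i ^+ k *: y) (x + 'i ^+ k *: y).
Proof.
pose c (k : 'I_4) : C := 'i ^+ k.
have E (k : 'I_4) : (4^-1 * c k) *: B (x + c k *: y) (x + c k *: y) =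
    4^-1 *: B x y + (c k * 4^-1) *: (B x x + B y y) + (c k ^+ 2 * 4^-1) *: B y x.
  have cc : c k * (c k)^* = 1 by rewrite -normCK normrX normCi expr1n expr1n.
  rewrite ![x + _]addrC Bl !Br !scalerDr !scalerA.
  have -> : 4^-1 * c k * c k * (c k)^* = c k * 4^-1.
    by rewrite -[_ * c k * _]mulrA cc mulr1 mulrC.
  have -> : 4^-1 * c k * (c k)^* = 4^-1 by rewrite -mulrA cc mulr1.
  have -> : 4^-1 * c k * c k = c k ^+ 2 * 4^-1 by rewrite -mulrA -expr2 mulrC.
  rewrite [4^-1 * c k]mulrC.
  move: (_ *: B y y) (_ *: B y x) (_ *: B x y) (_ *: B x x) => p q r s.
  by rewrite addrC -!addrA.
have i3 : ('i ^+ 3 : C) = - 'i by rewrite exprSr sqrCi mulN1r.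
have c1 : \sum_k c k = 0.
  by rewrite !big_ord_recr big_ord0 /c /= i3 sqrCi; ring.
have c2 : \sum_k c k ^+ 2 = 0.
  by rewrite !big_ord_recr big_ord0 /c /= i3 sqrrN sqrCi; ring.
rewrite (eq_bigr _ (fun k _ => E k)) !big_split /= -!scaler_suml c1 c2.
rewrite !scale0r !addr0 sumr_const card_ord -[4^-1 *+ 4]mulr_natr.
by rewrite mulVf ?scale1r // pnatr_eq0.
Qed.

(** * Unordered sums of complex numbers *)

Section Sum.
Variables (R : realType) (I : choiceType).
Local Notation C := R[i].
Implicit Types (k : I -> C) (l : C) (E : {fset I}).

Definition psum k E : C := \sum_(i <- E) k i.

Definition has_sum k l : Prop :=
  (psum k : {fset I} -> C^o) @ totally --> (l : C^o).

Lemma has_sumP k l : has_sum k l <->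
  forall e : C, 0 < e -> exists E0, forall E, (E0 `<=` E)%fset -> `|l - psum k E| < e.
Proof.
split=> [/cvgrPdist_lt kl e e0|kl].
  by have [E0 _ h] := kl e e0; exists E0 => E /h.
by apply/cvgrPdist_lt => e e0; have [E0 h] := kl e e0; exists E0 => // E /h.
Qed.

Lemma has_sum_unique k l l' : has_sum k l -> has_sum k l' -> l = l'.
Proof. by apply: cvg_unique; exact: norm_hausdorff. Qed.

Lemma has_sumD k k' l l' : has_sum k l -> has_sum k' l' ->
  has_sum (fun i => k i + k' i) (l + l').
Proof.
move=> kl kl'; rewrite /has_sum.
have -> : psum (fun i => k i + k' i) = (psum k + psum k' :> ({fset I} -> C^o)).
  by apply/funext => E; rewrite /psum big_split.
exact: (cvgD kl kl').
Qed.

Lemma has_sumZ a k l : has_sum k l -> has_sum (fun i => a * k i) (a * l).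
Proof.
move=> kl; rewrite /has_sum.
have -> : psum (fun i => a * k i) = (fun E => a *: (psum k E : C^o)).
  by apply/funext => E; rewrite /psum -mulr_sumr.
exact: (@cvgZr _ C^o).
Qed.

Lemma has_sum_conj k l : has_sum k l -> has_sum (fun i => (k i)^* ) l^*.
Proof.
move=> /has_sumP kl; apply/has_sumP => e e0; have [E0 h] := kl e e0; exists E0 => E /h.
by rewrite /psum -rmorph_sum -rmorphB norm_conjC.
Qed.

Lemma has_sum_big (J : Type) (s : seq J) (k : J -> I -> C) (l : J -> C) :
  (forall j, has_sum (k j) (l j)) ->
  has_sum (fun i => \sum_(j <- s) k j i) (\sum_(j <- s) l j).
Proof.
move=> kl; elim: s => [|j s IH].
  rewrite big_nil; apply/has_sumP => e e0; exists fset0 => E _.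
  by rewrite /psum big1 ?subrr ?normr0 // => i _; rewrite big_nil.
rewrite big_cons; move: (has_sumD (kl j) IH).
by congr has_sum; apply/funext => i; rewrite big_cons.
Qed.

Lemma psum_le k E0 E : (forall i, 0 <= k i) -> (E0 `<=` E)%fset ->
  psum k E0 <= psum k E.
Proof.
move=> k0 sE; rewrite /psum [leRHS](big_fsetID _ (mem E0)) /=.
have -> : [fset x in E | x \in E0]%fset = E0.
  apply/fsetP => x; rewrite !inE /=.
  by case: (boolP (x \in E0)) => [/(fsubsetP sE)->|]; rewrite ?andbF.
by rewrite lerDl sumr_ge0.
Qed.

(** The partial sums increase with E, so they converge to their supremum; the
supremum is taken over the real parts, R[i] being only partially ordered. *)
Lemma has_sum_ge0 k M : (forall i, 0 <= k i) -> (forall E, psum k E <= M) ->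
  exists l, [/\ has_sum k l, forall E, psum k E <= l
    & forall M', (forall E, psum k E <= M') -> l <= M'].
Proof.
move=> k0 kM; pose S := [set complex.Re (psum k E) | E in [set: {fset I}]].
have psumR E : psum k E = (complex.Re (psum k E))%:C%C.
  by rewrite RRe_real // ger0_real // sumr_ge0.
have ubS M' : (forall E, psum k E <= M') -> ubound S (complex.Re M').
  by move=> kM' _ [E _ <-]; have := kM' E; rewrite lecE => /andP[].
have supS : has_sup S.
  split; first by exists (complex.Re (psum k fset0)), fset0.
  by exists (complex.Re M); exact: ubS.
have le_sup E : psum k E <= (sup S)%:C%C.
  by rewrite psumR lecR; apply: ub_le_sup; [case: supS|exists E].
exists (sup S)%:C%C; split => //.
- apply/has_sumP => e e0.
  have [Re0 eR] : 0 < complex.Re e /\ e = (complex.Re e)%:C%C.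
    by move: (e0); rewrite ltcE /= => /andP[/eqP im ->]; rewrite RRe_real // gtr0_real.
  have [_ [E0 _ <-] hE0] := sup_adherent Re0 supS.
  exists E0 => E /(psum_le k0) leE.
  rewrite ger0_norm ?subr_ge0 // ltrBlDr -ltrBlDl eR.
  apply: lt_le_trans leE; rewrite psumR -rmorphB ltcR.
  by rewrite {1}[X in X < _](_ : _ = sup S - complex.Re e) // addrC.
- move=> M' kM'; have := kM' fset0; rewrite /psum big_seq_fset0.
  move=> M0; rewrite -[leRHS](RRe_real (ger0_real M0)) lecR.
  by apply: ge_sup; [case: supS|exact: ubS].
Qed.

End Sum.

(** * The inner product space l^2(I) *)

Section L2.
Variables (R : realType) (I : choiceType).
Local Notation C := R[i].

Definition sq_bounded (f : I -> C^o) : Prop :=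
  exists M : C, forall E : {fset I}, psum (fun i => `|f i| ^+ 2) E <= M.

Definition l2_pred : {pred I -> C^o} := fun f => `[< sq_bounded f >].

Lemma sqr_normD (x y : C) : `|x + y| ^+ 2 <= 2 * `|x| ^+ 2 + 2 * `|y| ^+ 2.
Proof.
have le1 : `|x + y| ^+ 2 <= (`|x| + `|y|) ^+ 2.
  by rewrite ler_sqr ?nnegrE ?addr_ge0 ?ler_normD.
apply: le_trans le1 _; rewrite -subr_ge0.
have -> : 2 * `|x| ^+ 2 + 2 * `|y| ^+ 2 - (`|x| + `|y|) ^+ 2 = (`|x| - `|y|) ^+ 2 by ring.
by rewrite real_exprn_even_ge0 // rpredB ?normr_real.
Qed.

Lemma l2_submod : submod_closed l2_pred.
Proof.
split=> [|a u v /asboolP[M hM] /asboolP[N hN]]; apply/asboolP.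
  exists 0 => E; rewrite /psum big1 // => i _.
  by rewrite normr0 expr0n.
exists (2 * (`|a| ^+ 2 * M) + 2 * N) => E.
have le : psum (fun i => `|(a *: u + v) i| ^+ 2) E <=
    2 * (`|a| ^+ 2 * psum (fun i => `|u i| ^+ 2) E) + 2 * psum (fun i => `|v i| ^+ 2) E.
  rewrite /psum !mulr_sumr -big_split; apply: ler_sum => i _ /=.
  by apply: le_trans (sqr_normD _ _) _; rewrite normrM exprMn.
apply: le_trans le _; apply: lerD; rewrite ler_pM2l ?ltr0n //.
by apply: ler_wpM2l => //; rewrite exprn_ge0.
Qed.

HB.instance Definition _ := GRing.isSubmodClosed.Build C (I -> C^o) l2_pred l2_submod.

Record l2 := L2 { l2_val :> I -> C^o; _ : l2_val \in l2_pred }.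

HB.instance Definition _ := [isSub for l2_val].
HB.instance Definition _ := [Choice of l2 by <:].
HB.instance Definition _ := [SubChoice_isSubLmodule of l2 by <:].

Implicit Types x y : l2.

Lemma l2P (x : l2) : sq_bounded x.
Proof. by case: x => x /= /asboolP. Qed.

Lemma l2_linE (a : C) (x y : l2) i : (a *: x + y) i = a * x i + y i.
Proof. by []. Qed.

Lemma l2_ext (x y : l2) : (forall i, x i = y i) -> x = y.
Proof. by move=> e; apply/val_inj/funext. Qed.

Lemma summable_sq (x : l2) : exists l : C, [/\ has_sum (fun i => `|x i| ^+ 2) l,
  forall E, psum (fun i => `|x i| ^+ 2) E <= l &
  forall M, (forall E, psum (fun i => `|x i| ^+ 2) E <= M) -> l <= M].
Proof.
have [M hM] := l2P x; apply: has_sum_ge0 hM => i.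
by rewrite exprn_ge0.
Qed.

(** By polarization x_i conj(y_i) is a combination of the terms |z_i|^2 for
four elements z of l^2(I), and these are summable by monotone convergence. *)
Lemma summable_mul (x y : l2) : exists l : C, has_sum (fun i => x i * (y i)^* ) l.
Proof.
have /choice[l hl] (z : l2) : exists l : C, has_sum (fun i => z i * (z i)^* ) l.
  have [l [hl _ _]] := summable_sq z; exists l.
  by move: hl; congr has_sum; apply/funext => i; rewrite normCK.
pose c (k : 'I_4) : C := 4^-1 * 'i ^+ k.
exists (\sum_k c k * l (x + 'i ^+ k *: y)).
have := @has_sum_big _ _ _ (index_enum 'I_4) _ _
  (fun k => has_sumZ (a:=c k) (hl (x + 'i ^+ k *: y))).
congr has_sum; apply/funext => i.
rewrite (@polarization _ C^o C^o (fun a b => a * b^* )) //.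
  by move=> a u v w; rewrite mulrDl -mulrA.
by move=> a u v w; rewrite rmorphD rmorphM mulrDr mulrCA.
Qed.

Definition l2_dot (x y : l2) : C :=
  xget 0 [set l | has_sum (fun i => x i * (y i)^* ) l].

Lemma l2_dot_sum x y : has_sum (fun i => x i * (y i)^* ) (l2_dot x y).
Proof. by have [l hl] := summable_mul x y; exact: (xgetI 0 hl). Qed.

Arguments l2_dot_sum : clear implicits.

Lemma l2_dot_herm x y : l2_dot x y = (-1) ^+ false * (l2_dot y x)^*.
Proof.
rewrite expr0 mul1r; apply: (has_sum_unique (l2_dot_sum x y)).
move: (has_sum_conj (l2_dot_sum y x)); congr has_sum; apply/funext => i.
by rewrite rmorphM /= conjCK mulrC.
Qed.

Lemma l2_dot_linl y : GRing.linear_for *%R (l2_dot ^~ y).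
Proof.
move=> a x x' /=; apply: (has_sum_unique (l2_dot_sum _ _)).
move: (has_sumD (has_sumZ (a:=a) (l2_dot_sum x y)) (l2_dot_sum x' y)).
by congr has_sum; apply/funext => i; rewrite l2_linE mulrDl mulrA.
Qed.

Lemma l2_dot_linr x : GRing.linear_for (@Num.conj C \; *%R) (l2_dot x).
Proof.
move=> a y y' /=; rewrite !(l2_dot_herm x) !expr0 !mul1r l2_dot_linl.
by rewrite rmorphD rmorphM.
Qed.

HB.instance Definition _ := bilinear_isBilinear.Build C l2 l2 C
  *%R (@Num.conj C \; *%R) l2_dot (l2_dot_linl, l2_dot_linr).
HB.instance Definition _ := isHermitianSesquilinear.Build C l2 false
  (@Num.conj C) l2_dot l2_dot_herm.

Lemma psum_le_dot x E : psum (fun i => `|x i| ^+ 2) E <= l2_dot x x.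
Proof.
have [l [hl le _]] := summable_sq x.
rewrite (_ : l2_dot x x = l) //; apply: has_sum_unique hl.
by move: (l2_dot_sum x x); congr has_sum; apply/funext => i; rewrite normCK.
Qed.

Lemma l2_dot_le x M : (forall E, psum (fun i => `|x i| ^+ 2) E <= M) -> l2_dot x x <= M.
Proof.
have [l [hl _ le]] := summable_sq x.
rewrite (_ : l2_dot x x = l); first exact: le.
apply: has_sum_unique hl.
by move: (l2_dot_sum x x); congr has_sum; apply/funext => i; rewrite normCK.
Qed.

Lemma coord_le_dot x i : `|x i| ^+ 2 <= l2_dot x x.
Proof. by have := psum_le_dot x [fset i]%fset; rewrite /psum big_seq_fset1. Qed.

Lemma l2_dot_gt0 x : x != 0 -> 0 < l2_dot x x.
Proof.
move=> nz_x; have [i xi] : exists i, x i != 0.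
  apply: contrapT => /forallNP x0; case/eqP: nz_x; apply: l2_ext => i.
  by have /negP/negPn/eqP-> := x0 i.
by apply: lt_le_trans (coord_le_dot x i); rewrite exprn_gt0 ?normr_gt0.
Qed.

HB.instance Definition _ := isDotProduct.Build C l2 l2_dot l2_dot_gt0.

Lemma l2_normZ (a : C) x : sqrtC (l2_dot (a *: x) (a *: x)) = `|a| * sqrtC (l2_dot x x).
Proof.
by rewrite dnormZ sqrtCM ?nnegrE ?exprn_ge0 ?dnorm_ge0 // sqrCK.
Qed.

Lemma l2_norm_eq0 x : sqrtC (l2_dot x x) = 0 -> x = 0.
Proof. by move/eqP; rewrite sqrt_dnorm_eq0 => /eqP. Qed.

HB.instance Definition _ := Lmodule_isNormed.Build C l2
  (dot_triangle l2_dot) l2_normZ l2_norm_eq0.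

Lemma l2_normE x : `|x| = sqrtC (l2_dot x x). Proof. by []. Qed.

Lemma l2_norm_sqr x : `|x| ^+ 2 = l2_dot x x. Proof. by rewrite l2_normE sqrtCK. Qed.
End L2.

Arguments l2_dot_sum {R I} x y.

(** * Completeness of l^2(I) *)

Section ComplexLimit.
Variable R : realType.
Local Notation C := R[i].

Lemma normc_ge_Im (z : C) : `|complex.Im z|%:C%C <= `|z|.
Proof.
have := normc_ge_Re (z * 'i%C); rewrite ReiNIm normrN normrM.
by rewrite (_ : `|'i%C| = 1 :> C) ?mulr1 // normc_def /= expr0n expr1n add0r sqrtr1.
Qed.

Lemma normc_le_ReIm (z : C) :
  `|z| <= `|complex.Re z|%:C%C + `|complex.Im z|%:C%C.
Proof.
rewrite [in leLHS](complexE z); apply: le_trans (ler_normD _ _) _.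
rewrite normrM (_ : `|'i%C| = 1 :> C) ?mul1r; last first.
  by rewrite normc_def /= expr0n expr1n add0r sqrtr1.
by rewrite !normc_def /= expr0n /= !addr0 !sqrtr_sqr.
Qed.

(** A Cauchy criterion for functions with values in R[i], with its limit in
epsilon form: it follows from completeness of R applied to the real and
imaginary parts. *)
Lemma cauchy_complex (T : Type) (F : set_system T) (FF : ProperFilter F)
    (g : T -> C) :
  (forall e : C, 0 < e -> exists z, F [set t | `|z - g t| < e]) ->
  exists l, forall e : C, 0 < e -> F [set t | `|l - g t| < e].
Proof.
move=> gc.
have part (p : C -> R) : (forall x y, p (x - y) = p x - p y) ->
    (forall z, `|p z|%:C%C <= `|z|) ->
    exists a : R, forall e : R, 0 < e -> F [set t | `|a - p (g t)| < e].
  move=> pB ple.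
  have : cauchy ((p \o g) @ F).
    apply: cauchy_exP => e e0; have [|z Fz] := gc e%:C%C; first by rewrite ltcR.
    exists (p z); rewrite -ball_normE.
    suff : F [set t | `|p z - p (g t)| < e] by [].
    apply: filterS Fz => t /= lt.
    by rewrite -pB -ltcR; exact: le_lt_trans (ple _) lt.
  by move=> /cauchy_cvg /cvg_ex[a /cvgrPdist_lt ha]; exists a => e e0; exact: ha.
have [a ha] := part (@complex.Re R) (fun x y => raddfB _ x y) (@normc_ge_Re R).
have [b hb] := part (@complex.Im R) (fun x y => raddfB _ x y) normc_ge_Im.
exists (a +i* b)%C => e e0.
have [Re0 eR] : 0 < complex.Re e /\ e = (complex.Re e)%:C%C.
  by move: (e0); rewrite ltcE /= => /andP[/eqP im ->]; rewrite RRe_real // gtr0_real.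
have e2 : 0 < complex.Re e / 2 by rewrite divr_gt0.
apply: filterS2 (ha _ e2) (hb _ e2) => t /= lta ltb.
apply: le_lt_trans (normc_le_ReIm _) _.
rewrite eR -rmorphD ltcR.
rewrite (splitr (complex.Re e)) ltrD //.
  by move: lta; case: (g t).
by move: ltb; case: (g t).
Qed.

End ComplexLimit.

Section L2Complete.
Variables (R : realType) (I : choiceType).
Local Notation C := R[i].
Local Notation l2 := (l2 R I).

Lemma coord_le_norm (x : l2) i : `|x i| <= `|x|.
Proof. by rewrite -ler_sqr ?nnegrE // l2_norm_sqr coord_le_dot. Qed.

(** The coordinates of a Cauchy filter converge to a function l. If the filter
contains the ball of radius e at h, the partial sums of |h - l|^2 are bounded
by (2e)^2: on a finite set E compare h and l with some k in that ball which is
close to l on all of E. So h - l lies in l^2(I), hence l does, and it is the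
limit in norm. *)
Lemma l2_complete (F : set_system l2) : ProperFilter F -> cauchy F -> cvg F.
Proof.
move=> FF /cauchyP Fc.
have {}Fc (e : C) : 0 < e -> exists h : l2, F [set f | `|h - f| < e].
  by move=> /Fc[h]; rewrite -ball_normE => Fh; exists h.
have /choice[l hl] (i : I) :
    exists l : C, forall e : C, 0 < e -> F [set f : l2 | `|l - f i| < e].
  apply: cauchy_complex => e /Fc[h Fh]; exists (h i).
  by apply: filterS Fh => f /=; apply: le_lt_trans; exact: (coord_le_norm (h - f)).
have near_l (h : l2) (e : C) (E : {fset I}) : 0 < e -> F [set f | `|h - f| < e] ->
    psum (fun i => `|h i - l i| ^+ 2) E <= (2 * e) ^+ 2.
  (* |E| coordinates at distance d contribute |E| d^2 <= e^2 *)
  move=> e0 Fh; pose d := e / (size E).+1%:R.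
  have d0 : 0 < d by rewrite divr_gt0 // ltr0n.
  have FE : F [set f : l2 | forall i : E, `|l (val i) - f (val i)| < d].
    by apply: filter_forall => i; exact: hl.
  have [k [hk lk]] := filter_ex (filterI Fh FE).
  have le1 : psum (fun i => `|h i - l i| ^+ 2) E <=
      2 * psum (fun i => `|(h - k) i| ^+ 2) E + 2 * \sum_(i <- E) d ^+ 2.
    rewrite /psum !mulr_sumr -big_split big_seq [leRHS]big_seq.
    apply: ler_sum => i iE /=.
    have -> : h i - l i = (h - k) i + (k i - l i) by rewrite addrA subrK.
    apply: le_trans (sqr_normD _ _) _; rewrite lerD2l ler_pM2l ?ltr0n //.
    rewrite ler_sqr ?nnegrE // ?(ltW d0) // distrC.
    exact: ltW (lk [` iE]%fset).
  apply: le_trans le1 _.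
  have -> : (2 * e) ^+ 2 = 2 * e ^+ 2 + 2 * e ^+ 2 by ring.
  apply: lerD; rewrite ler_pM2l ?ltr0n //.
    apply: le_trans (psum_le_dot _ _) _.
    by rewrite -l2_norm_sqr ler_sqr ?nnegrE ?(ltW e0) // ltW.
  rewrite big_const_seq count_predT iter_addr_0 /d expr_div_n -mulrnAr.
  rewrite -[leRHS]mulr1 ler_pM2l ?exprn_gt0 // -[_ *+ size E]mulr_natl.
  rewrite ler_pdivrMr ?mul1r ?exprn_gt0 ?ltr0n // -natrX ler_nat.
  by rewrite (leq_trans (leqnSn _)) // -{1}[(size E).+1]expn1 leq_pexp2l.
have [h1 Fh1] := Fc 1 ltr01.
have w_in : (fun i => h1 i - l i : C^o) \in @l2_pred R I.
  by apply/asboolP; exists ((2 * 1) ^+ 2) => E; exact: near_l.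
pose L : l2 := h1 - L2 w_in.
have LE i : L i = l i by rewrite /L /= opprB addrC subrK.
apply/cvg_ex; exists L; apply/cvgrPdist_lt => e e0.
have e4 : 0 < e / 4 by rewrite divr_gt0 ?ltr0n.
have [h Fh] := Fc _ e4.
have hL : `|h - L| <= 2 * (e / 4).
  have e4' : 0 <= 2 * (e / 4) by apply: mulr_ge0; [exact: ler0n|exact: ltW].
  rewrite -ler_sqr ?nnegrE // l2_norm_sqr.
  apply: l2_dot_le => E; apply: le_trans (near_l h _ E e4 Fh).
  by rewrite /psum; apply: ler_sum => i _; rewrite -LE.
apply: filterS Fh => f /= hf.
have -> : L - f = (h - f) - (h - L) by rewrite opprB [RHS]addrC addrA subrK.
apply: le_lt_trans (ler_normB _ _) _.
apply: lt_le_trans (ltr_leD hf hL) _.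
have -> : e / 4 + 2 * (e / 4) = e - e / 4 by field.
by rewrite gerBl ltW.
Qed.

HB.instance Definition _ := Uniform_isComplete.Build l2 l2_complete.

End L2Complete.

(** * The left regular representation separates group elements *)

Section Regular.
Variables (R : realType) (G : groupType).
Local Notation C := R[i].
Local Notation l2 := (l2 R G).

Lemma psum_translate (k : G -> C) s (E : {fset G}) :
  psum (fun g => k (s * g)%g) E = psum k [fset (s * g)%g | g in E]%fset.
Proof.
rewrite /psum big_imfset //= => g h _ _; exact: mulgI.
Qed.

(** Translation permutes the finite subsets of G and preserves inclusion. *)
Lemma has_sum_translate (k : G -> C) (l : C) s :
  has_sum k l -> has_sum (fun g => k (s * g)%g) l.
Proof.
move=> /has_sumP kl; apply/has_sumP => e e0; have [E0 h] := kl e e0.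
exists [fset (s^-1 * g)%g | g in E0]%fset => E sE.
rewrite psum_translate; apply: h; apply/fsubsetP => g gE0.
apply/imfsetP; exists (s^-1 * g)%g; last by rewrite mulVKg.
by apply: (fsubsetP sE); apply/imfsetP; exists g.
Qed.

Lemma translate_in s (x : l2) : (fun g => x (s^-1 * g)%g : C^o) \in @l2_pred R G.
Proof.
apply/asboolP; have [M hM] := l2P x; exists M => E.
by rewrite (psum_translate (fun g => `|x g| ^+ 2)).
Qed.

Definition translate s (x : l2) : l2 := L2 (translate_in s x).

Lemma translate_linear s : linear (translate s).
Proof. by move=> a x y; apply: l2_ext => g. Qed.

HB.instance Definition _ s :=
  GRing.isLinear.Build C l2 l2 *:%R (translate s) (translate_linear s).

Lemma translate_unitary :
  unitary_rep (@l2_dot R G) (fun s => translate s : {linear l2 -> l2}).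
Proof.
split=> [s x y|x|s t x].
- apply: (has_sum_unique (l2_dot_sum _ _)).
  exact: (@has_sum_translate _ _ s^-1%g (l2_dot_sum x y)).
- by apply: l2_ext => g; rewrite /= invg1 mul1g.
- by apply: l2_ext => g; rewrite /= invgM mulgA.
Qed.

Lemma basis_in : (fun g => (g == 1%g)%:R : C^o) \in @l2_pred R G.
Proof.
apply/asboolP; exists 1 => E; rewrite /psum.
have [E1|nE1] := boolP (1%g \in E).
  rewrite (big_fsetD1 1%g) //= eqxx normr1 expr1n big1_seq ?addr0 // => g.
  by rewrite in_fsetD1 => /andP[_ /andP[/negPf-> _]]; rewrite normr0 expr0n.
rewrite big1_seq ?ler01 // => g /andP[_ gE].
by rewrite (_ : (g == _) = false) ?normr0 ?expr0n //; apply: contraNF nE1 => /eqP<-.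
Qed.

Variables (A : cstarAlg R) (delta : G -> A).

(** The coordinates of rho(a) e_1, for the extension rho of the left regular
representation; as a consequence the delta_s are linearly independent. *)
Lemma delta_coef : is_group_cstar delta ->
  exists coef : G -> A -> C,
    (forall g c a b, coef g (c *: a + b) = c * coef g a + coef g b) /\
    forall g s, coef g (delta s) = (s == g)%:R.
Proof.
move=> hdelta.
have [rho [[_ rho_lin _ _ _] rhoE]] :=
  group_cstar_universal hdelta (@l2_norm_sqr R G) translate_unitary.
exists (fun g a => rho a (L2 basis_in) g); split=> [g c a b|g s].
  by rewrite rho_lin.
by rewrite rhoE /= mulg_eq1 eqg_inv.
Qed.

End Regular.

(** * Linear spans and Hermitian forms *)

Section LinSpanLemmas.
Variables (K : pzRingType) (V : lmodType K) (S : set V).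

Lemma lin_span_gen v : S v -> lin_span S v.
Proof. by move=> /sub_lin_span; rewrite inE. Qed.

Lemma lin_span_lin a u v : lin_span S u -> lin_span S v -> lin_span S (a *: u + v).
Proof.
by move=> Su Sv; have := (lin_span_submod S).2 a u v; rewrite !inE; exact.
Qed.

Lemma lin_span0 : lin_span S 0.
Proof. by have := (lin_span_submod S).1; rewrite inE. Qed.

Lemma lin_span_sum (I : Type) (r : seq I) (c : I -> K) (x : I -> V) :
  (forall i, lin_span S (x i)) -> lin_span S (\sum_(i <- r) c i *: x i).
Proof.
move=> Sx; elim: r => [|i r IH]; first by rewrite big_nil; exact: lin_span0.
by rewrite big_cons; exact: lin_span_lin.
Qed.

Lemma span_typeP (x : span_type S) : lin_span S (span_val x).
Proof. by case: x => x /=; rewrite inE. Qed.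

End LinSpanLemmas.

Lemma linear_at0 (K : pzRingType) (U V : lmodType K) (f : U -> V) :
  linear f -> f 0 = 0.
Proof. by move=> fl; have := fl (-1) 0 0; rewrite scaler0 addr0 scaleN1r addNr. Qed.

Lemma linear_comb (K : pzRingType) (U V : lmodType K) (f : U -> V) (I : Type)
    (r : seq I) (c : I -> K) (x : I -> U) : linear f ->
  f (\sum_(i <- r) c i *: x i) = \sum_(i <- r) c i *: f (x i).
Proof.
move=> fl; elim: r => [|i r IH]; first by rewrite !big_nil linear_at0.
by rewrite !big_cons fl IH.
Qed.

Lemma linear_scale (K : pzRingType) (U V : lmodType K) (f : U -> V) a x :
  linear f -> f (a *: x) = a *: f x.
Proof. by move=> fl; rewrite -[a *: x]addr0 fl (linear_at0 fl) addr0. Qed.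

Section BlockForm.
Variable R : realType.
Local Notation C := R[i].

Definition hform n (v : 'cV[C]_n) (T : 'M[C]_n) (w : 'cV[C]_n) : 'M[C]_1 :=
  map_mx Num.conj v^T *m T *m w.

Lemma hform_linear n v w : linear (fun T : 'M[C]_n => hform v T w).
Proof.
by move=> a T T'; rewrite /hform mulmxDr mulmxDl -scalemxAr -scalemxAl.
Qed.

Lemma hform_linr n (v : 'cV[C]_n) T : linear (hform v T).
Proof. by move=> a w w'; rewrite /hform mulmxDr -scalemxAr. Qed.

Lemma hform_linl n a (v v' : 'cV[C]_n) T w :
  hform (a *: v + v') T w = a^* *: hform v T w + hform v' T w.
Proof.
rewrite /hform [(_ + _)^T]linearD /= [(a *: v)^T]linearZ /= map_mxD map_mxZ.
by rewrite !mulmxDl -!scalemxAl.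
Qed.

Lemma hform_suml n (I : Type) (r : seq I) c (v : I -> 'cV[C]_n) T w :
  hform (\sum_(i <- r) c i *: v i) T w = \sum_(i <- r) (c i)^* *: hform (v i) T w.
Proof.
elim: r => [|i r IH]; last by rewrite !big_cons hform_linl IH.
by rewrite !big_nil /hform trmx0 map_mx0 !mul0mx.
Qed.

Lemma hform_scalel n a (v : 'cV[C]_n) T w : hform (a *: v) T w = a^* *: hform v T w.
Proof.
rewrite -[a *: v]addr0 hform_linl [X in _ + X](_ : _ = 0) ?addr0 //.
by rewrite /hform trmx0 map_mx0 !mul0mx.
Qed.

Lemma hform1 (a b z : 'M[C]_1) : hform a z b = const_mx ((a 0 0)^* * z 0 0 * b 0 0).
Proof.
by apply/matrixP => i j; rewrite !ord1 /hform; do 3 rewrite ?mxE ?big_ord1.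
Qed.

(** A rank one form is the product of its two linear factors. *)
Lemma hform_outer n (v x y : 'cV[C]_n) :
  hform x (v *m map_mx Num.conj v^T) y =
  const_mx (((map_mx Num.conj v^T *m x) 0 0)^* * (map_mx Num.conj v^T *m y) 0 0).
Proof.
have xv : map_mx Num.conj x^T *m v = const_mx ((map_mx Num.conj v^T *m x) 0 0)^*.
  apply/matrixP => i j; rewrite !ord1 !mxE rmorph_sum; apply: eq_bigr => k _.
  by rewrite !mxE rmorphM /= conjCK mulrC.
rewrite /hform mulmxA xv -mulmxA; move: (_ *m y) => M.
by apply/matrixP => i j; rewrite !ord1 mxE big_ord1 !mxE.
Qed.

Lemma hform11 (z : C) :
  hform (const_mx 1 : 'cV_1) (const_mx z) (const_mx 1) 0 0 = z.
Proof.
by rewrite /hform; do 3 rewrite ?mxE ?big_ord1; rewrite rmorph1 mul1r mulr1.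
Qed.

(** Nonnegativity in R[i] includes being real, and z is real because z + r w
and r w are. *)
Lemma ge0_addgt (z w : C) : 0 <= w -> (forall r : C, 0 < r -> 0 <= z + r * w) -> 0 <= z.
Proof.
move=> w0 h.
have [w00|nw] := eqVneq w 0; first by have := h 1 ltr01; rewrite w00 mulr0 addr0.
have wgt : 0 < w by rewrite lt_def nw.
have {}h e : 0 < e -> 0 <= z + e.
  by move=> e0; have := h (e / w) (divr_gt0 e0 wgt); rewrite divfK.
have zr : z \is Num.real.
  by rewrite -(addrK 1 z) rpredB ?rpred1 // ger0_real // h.
rewrite real_leNgt ?rpred0 //; apply/negP => z0.
have := h (- z / 2); rewrite divr_gt0 ?oppr_gt0 ?ltr0n // => /(_ isT).
have -> : z + - z / 2 = z / 2 by field.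
by rewrite pmulr_lge0 ?invr_gt0 ?ltr0n // => /le_lt_trans/(_ z0); rewrite ltxx.
Qed.

End BlockForm.

(** * Squares in the operator system, and the two positivity notions *)

Section Key.
Variables (R : realType) (G : groupType) (A : cstarAlg R) (delta : G -> A).
Hypothesis hdelta : is_group_cstar delta.
Variable D : set G.
Hypothesis D1 : D 1%g.
Local Notation C := R[i].
Local Notation X := (UOS D delta).

Lemma cadj_delta t : cadj (delta t) = delta t^-1%g.
Proof.
have [u1 _] := group_cstar_unitary hdelta t.
rewrite -[LHS]mulr1 -(group_cstar1 hdelta) -(mulgV t) (group_cstarM hdelta).
by rewrite mulrA u1 mul1r.
Qed.

Lemma cadj0 : cadj (0 : A) = 0.
Proof. by have := cadjZ (0 : C) (0 : A); rewrite !scale0r rmorph0 scale0r. Qed.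

Lemma cadj_sum (I : Type) (r : seq I) (x : I -> A) :
  cadj (\sum_(i <- r) x i) = \sum_(i <- r) cadj (x i).
Proof.
by elim: r => [|i r IH]; rewrite ?big_nil ?cadj0 // !big_cons cadjD IH.
Qed.

Lemma square_entry m (E : {fset G}) (a : G -> 'M[C]_m)
    (y := \sum_(s <- E) tensmx (a s) (delta s)) i j :
  (y *m adjmx y) i j = \sum_k \sum_(s <- E) \sum_(t <- E)
    (a s i k * (a t j k)^* ) *: delta (s * t^-1)%g.
Proof.
have yE i' k : y i' k = \sum_(s <- E) a s i' k *: delta s.
  by rewrite summxE; apply: eq_bigr => s _; rewrite mxE.
rewrite mxE; apply: eq_bigr => k _; rewrite !mxE !yE cadj_sum big_distrl /=.
apply: eq_bigr => s _; rewrite big_distrr /=; apply: eq_bigr => t _.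
by rewrite cadjZ -scalerAl -scalerAr scalerA cadj_delta (group_cstarM hdelta).
Qed.

(** The value 0 outside D makes sums over s t^-1 well-typed without a proof
that s t^-1 lies in D; it parallels zero_ext. *)
Definition dlift (g : G) : X := oapp (UOS_delta delta) 0 (insub g : option D).

Lemma dliftE g : D g -> span_val (dlift g) = delta g.
Proof.
move=> Dg; rewrite /dlift; case: insubP => [s _ <- //|].
by case/negP; exact: mem_set.
Qed.

Lemma zero_ext_lin n (phi : X -> 'M[C]_n) g : linear phi ->
  zero_ext (fun s => phi (UOS_delta delta s)) g = phi (dlift g).
Proof.
move=> lphi; rewrite /zero_ext /dlift; case: (insub g) => //=.
by rewrite linear_at0.
Qed.

(** The square y y^* of y = sum_(s in E) a_s (x) delta_s, as a matrix over the
operator system itself rather than over the C*-algebra (see [square_mxE]); only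
there can a map that is defined on the operator system be applied to it. *)
Definition square_mx m (E : {fset G}) (a : G -> 'M[C]_m) : 'M[X]_m :=
  \matrix_(i, j) \sum_k \sum_(s : E) \sum_(t : E)
    (a (val s) i k * (a (val t) j k)^* ) *: dlift (val s * (val t)^-1)%g.

Lemma span_val_sum (I : Type) (r : seq I) (x : I -> X) :
  span_val (\sum_(i <- r) x i) = \sum_(i <- r) span_val (x i).
Proof. by elim: r => [|i r IH]; rewrite ?big_nil // !big_cons -IH. Qed.

Lemma square_mxE m (E : {fset G}) (a : G -> 'M[C]_m) : admissible D E ->
  map_mx (@span_val _ _ _) (square_mx E a) =
  (let y := \sum_(s <- E) tensmx (a s) (delta s) in y *m adjmx y).
Proof.
move=> admE; apply/matrixP => i j; rewrite square_entry !mxE span_val_sum.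
apply: eq_bigr => k _; rewrite span_val_sum.
rewrite [RHS]big_seq_fsetE; apply: eq_bigr => s _ /=.
rewrite span_val_sum [RHS]big_seq_fsetE; apply: eq_bigr => t _ /=.
rewrite -(dliftE (g := (val s * (val t)^-1)%g)) //.
by apply: admE; exact: valP.
Qed.

(** The computation behind the whole duality: applying phi to a square and
pairing with xi gives, for each column k of the coefficients, the form that
tests positive semi-definiteness of s |-> phi delta_s. *)
Lemma hform_square m n (E : {fset G}) (a : G -> 'M[C]_m) (phi : X -> 'M[C]_n)
    (xi : 'I_m -> 'cV[C]_n) : linear phi ->
  \sum_i \sum_j hform (xi i) (phi (square_mx E a i j)) (xi j) =
  \sum_k \sum_(s : E) \sum_(t : E)
    hform (\sum_i (a (val s) i k)^* *: xi i)
      (phi (dlift (val s * (val t)^-1)%g)) (\sum_j (a (val t) j k)^* *: xi j).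
Proof.
move=> lphi.
have phi_sum (I : Type) (r : seq I) (x : I -> X) :
    phi (\sum_(i <- r) x i) = \sum_(i <- r) phi (x i).
  have := linear_comb r (fun=> 1) x lphi.
  under eq_bigr do rewrite scale1r.
  by under [in X in _ = X -> _]eq_bigr do rewrite scale1r.
have hsum (I : Type) (r : seq I) (v w : 'cV[C]_n) (x : I -> 'M[C]_n) :
    hform v (\sum_(i <- r) x i) w = \sum_(i <- r) hform v (x i) w.
  by rewrite /hform mulmx_sumr mulmx_suml.
have exch (I J S T : finType) (F : I -> J -> S -> T -> 'M[C]_1) :
    \sum_i \sum_j \sum_s \sum_t F i j s t = \sum_j \sum_s \sum_t \sum_i F i j s t.
  rewrite exchange_big; apply: eq_bigr => j _; rewrite exchange_big.
  by apply: eq_bigr => s _; exact: exchange_big.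
transitivity (\sum_i \sum_j \sum_k \sum_(s : E) \sum_(t : E)
    (a (val s) i k * (a (val t) j k)^* ) *:
      hform (xi i) (phi (dlift (val s * (val t)^-1)%g)) (xi j)).
  apply: eq_bigr => i _; apply: eq_bigr => j _.
  rewrite mxE phi_sum hsum; apply: eq_bigr => k _.
  rewrite phi_sum hsum; apply: eq_bigr => s _.
  rewrite phi_sum hsum; apply: eq_bigr => t _.
  by rewrite linear_scale // /hform -scalemxAr -scalemxAl.
under eq_bigr do rewrite exch.
rewrite exch.
apply: eq_bigr => k _; apply: eq_bigr => s _; apply: eq_bigr => t _.
rewrite hform_suml; apply: eq_bigr => i _; rewrite conjCK.
rewrite (linear_comb _ _ _ (hform_linr _ _)) scaler_sumr; apply: eq_bigr => j _.
by rewrite scalerA.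
Qed.

Lemma square_selfadj m (y : 'M[A]_m) : adjmx (y *m adjmx y) = y *m adjmx y.
Proof.
apply/matrixP => i j; rewrite !mxE cadj_sum; apply: eq_bigr => k _.
by rewrite cadjM !mxE cadjK.
Qed.

Lemma admissible1 : admissible D [fset 1%g]%fset.
Proof. by move=> s t; rewrite !inE => /eqP-> /eqP->; rewrite invg1 mulg1. Qed.

Lemma unit_squareE m :
  (let y := \sum_(s <- [fset 1%g]%fset) tensmx 1%:M (delta s) in y *m adjmx y)
  = tensmx 1%:M (delta 1%g) :> 'M[A]_m.
Proof.
apply/matrixP => i j; rewrite (square_entry _ (fun=> 1%:M)).
under eq_bigr do rewrite !big_seq_fset1.
rewrite (bigD1 i) //= big1 ?addr0 => [|k /negPf ki].
  by rewrite !mxE eqxx mul1r invg1 mulg1 conjC_nat eq_sym.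
by rewrite !mxE eq_sym ki mul0r scale0r.
Qed.

Lemma tensmx_scalar m (r : C) (b : A) i j :
  (tensmx r%:M b : 'M[A]_m) i j = r *: (tensmx 1%:M b : 'M[A]_m) i j.
Proof. by rewrite !mxE scalerA mulr_natr. Qed.

(** A square plus r 1 (x) delta_1 lies in the generated cone since
1 (x) delta_1 is itself a square, with E = {1}; this uses that D contains 1. *)
Lemma square_cone m (E : {fset G}) (a : G -> 'M[C]_m) : admissible D E ->
  UOS_cone (square_mx E a).
Proof.
move=> admE; rewrite /UOS_cone /= square_mxE //; split; first exact: square_selfadj.
move=> r r0; set y := \sum_(s <- E) _.
exists 2%N, (fun i => if i == 0 then 1 else r),
  (fun i => if i == 0 then y *m adjmx y else tensmx 1%:M (delta 1%g)); split.
- by move=> i; case: ifP => _; rewrite ?ler01 // ltW.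
- move=> i; case: ifP => _.
    by exists E => //; exists 1%N, (fun=> a); rewrite big_ord1.
  exists [fset 1%g]%fset; [exact: admissible1|exists 1%N, (fun _ _ => 1%:M)].
    by rewrite big_ord1 unit_squareE.
- rewrite big_ord_recl big_ord1 /=; congr (_ + _); apply/matrixP => i j.
    by rewrite [RHS]mxE scale1r.
  by rewrite tensmx_scalar [RHS]mxE.
Qed.

Lemma block_square_ge0 m n (E : {fset G}) (a : G -> 'M[C]_m) (phi : X -> 'M[C]_n)
    (xi : 'I_m -> 'cV[C]_n) : linear phi ->
  Bpos (fun s => phi (UOS_delta delta s)) -> admissible D E ->
  0 <= (\sum_i \sum_j hform (xi i) (phi (square_mx E a i j)) (xi j)) 0 0.
Proof.
move=> lphi phi_pos admE; rewrite hform_square // summxE; apply: sumr_ge0 => k _.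
have := phi_pos E admE (fun s => \sum_i (a (val s) i k)^* *: xi i).
congr (0 <= fun_of_matrix _ 0 0).
by apply: eq_bigr => s _; apply: eq_bigr => t _; rewrite zero_ext_lin.
Qed.

(** On squares the form q of phi is nonnegative by [block_square_ge0]. For x in
the cone and r > 0, x + r 1 (x) delta_1 is a nonnegative combination of squares,
whence 0 <= q x + r q(1 (x) delta_1) for all r > 0, and so 0 <= q x. *)
Lemma Bpos_cp n (phi : X -> 'M[C]_n) : linear phi ->
  Bpos (fun s => phi (UOS_delta delta s)) -> completely_positive phi.
Proof.
move=> lphi phi_pos; split=> // m x [_ xU] xi.
rewrite -/(is_true _); pose q (z : 'M[X]_m) : C :=
  (\sum_i \sum_j hform (xi i) (phi (z i j)) (xi j)) 0 0.
have q_lin (J : Type) (r : seq J) (c : J -> C) (z : J -> 'M[X]_m) (z0 : 'M[X]_m) :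
    (forall i j, z0 i j = \sum_(l <- r) c l *: z l i j) ->
    q z0 = \sum_(l <- r) c l * q (z l).
  move=> z0E; rewrite /q.
  have -> : \sum_i \sum_j hform (xi i) (phi (z0 i j)) (xi j) =
      \sum_(l <- r) c l *: \sum_i \sum_j hform (xi i) (phi (z l i j)) (xi j).
    under [RHS]eq_bigr do rewrite scaler_sumr.
    rewrite [RHS]exchange_big; apply: eq_bigr => i _.
    under [RHS]eq_bigr do rewrite scaler_sumr.
    rewrite [RHS]exchange_big; apply: eq_bigr => j _.
    rewrite z0E (linear_comb _ _ _ lphi).
    exact: (linear_comb _ _ _ (hform_linear (xi i) (xi j))).
  by rewrite summxE; apply: eq_bigr => l _; rewrite mxE.
have q_sq (E : {fset G}) (a : G -> 'M[C]_m) : admissible D E -> 0 <= q (square_mx E a).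
  exact: block_square_ge0.
apply: (@ge0_addgt _ _ (q (square_mx [fset 1%g]%fset (fun=> 1%:M)))).
  by apply: q_sq; exact: admissible1.
(* the squares live in matrices over A: lift them back to the operator system *)
move=> r r0; pose e := square_mx [fset 1%g]%fset (fun=> 1%:M : 'M[C]_m).
have [p [c [y [c0 yQ yE]]]] := xU r r0.
have /choice[z hz] (i : 'I_p) :
    exists z : 'M[X]_m, map_mx (@span_val _ _ _) z = y i /\ 0 <= q z.
  have [E admE [N [a ->]]] := yQ i.
  exists (\matrix_(k, l) \sum_(j < N) square_mx E (a j) k l); split.
    apply/matrixP => k l; rewrite !mxE span_val_sum summxE; apply: eq_bigr => j _.
    by rewrite -square_mxE // [RHS]mxE.
  rewrite (q_lin _ (index_enum 'I_N) (fun=> 1) (fun j => square_mx E (a j))).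
    by apply: sumr_ge0 => j _; rewrite mul1r q_sq.
  by move=> k l; rewrite mxE; apply: eq_bigr => j _; rewrite scale1r.
pose x1 : 'M[X]_m := \matrix_(i, j) (x i j + r *: e i j).
have <- : q x1 = q x + r * q e.
  rewrite (q_lin _ [:: true; false] (fun b => if b then 1 else r)
    (fun b => if b then x else e)).
    by rewrite big_cons big_seq1 mul1r.
  by move=> i j; rewrite mxE big_cons big_seq1 scale1r.
have -> : q x1 = \sum_i c i * q (z i).
  apply: q_lin => i j; apply: val_inj => /=; rewrite span_val_sum.
  have := congr1 (fun M : 'M[A]_m => M i j) yE; rewrite summxE.
  rewrite mxE [X in X + _ = _ -> _]mxE => E1.
  have -> : span_val (x1 i j) = span_val (x i j) + r *: span_val (e i j) by rewrite mxE.
  have -> : span_val (e i j) = (tensmx 1%:M (delta 1%g) : 'M[A]_m) i j.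
    by rewrite -unit_squareE -square_mxE ?[RHS]mxE //; exact: admissible1.
  rewrite -tensmx_scalar.
  by rewrite E1; apply: eq_bigr => k _; rewrite mxE -(proj1 (hz k)) mxE.
apply: sumr_ge0 => i _; apply: mulr_ge0 => //; exact: (proj2 (hz i)).
Qed.

End Key.

(** * Functionals on the operator system as functions on D *)

Section Converse.
Variables (R : realType) (G : groupType) (A : cstarAlg R) (delta : G -> A).
Hypothesis hdelta : is_group_cstar delta.
Variable D : set G.
Hypothesis D1 : D 1%g.
Local Notation C := R[i].
Local Notation X := (UOS D delta).

(** Enumerate E as s_1, ..., s_m and let a_(s_i) be the matrix unit E_(i, k0)
for a fixed column k0: the square is then the matrix of the delta_(s_i s_j^-1),
and its form under phi is the one that tests phi o delta on E. *)
Lemma cp_Bpos n (phi : X -> 'M[C]_n) : completely_positive phi ->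
  Bpos (fun s => phi (UOS_delta delta s)).
Proof.
move=> [lphi cphi] E admE xi; pose m := #|{: E}|.
case: (pickP (fun _ : 'I_m => true)) => [k0 _|noI]; last first.
  rewrite big1 ?mxE // => s _; by have := noI (enum_rank s).
pose a (g : G) : 'M[C]_m :=
  \matrix_(i, k) ((g == val (enum_val i)) && (k == k0))%:R.
pose eta (i : 'I_m) := xi (enum_val i).
have : 0 <= (\sum_i \sum_j hform (eta i) (phi (square_mx delta D E a i j)) (eta j)) 0 0.
  exact: (cphi m _ (square_cone hdelta D1 a admE)).
rewrite (hform_square E a eta lphi).
have aE (s : E) k : \sum_i (a (val s) i k)^* *: eta i = (k == k0)%:R *: xi s.
  rewrite (bigD1 (enum_rank s)) //= big1 ?addr0 => [|i /negPf si].
    by rewrite /eta mxE enum_rankK eqxx conjC_nat.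
  rewrite mxE (_ : (_ == _) = false) ?conjC_nat ?scale0r //=.
  by apply: contraFF si => /eqP/val_inj->; rewrite enum_valK.
congr (0 <= fun_of_matrix _ 0 0).
rewrite (bigD1 k0) //= [X in _ + X]big1 ?addr0 => [|k /negPf kk0]; last first.
  apply: big1 => s _; apply: big1 => t _.
  by rewrite !aE kk0 !scale0r /hform trmx0 map_mx0 !mul0mx.
apply: eq_bigr => s _; apply: eq_bigr => t _.
by rewrite !aE eqxx !scale1r zero_ext_lin.
Qed.

Lemma const_mx_linear (f : X -> C^o) : linear f ->
  linear (fun x => const_mx (f x) : 'M[C]_1).
Proof. by move=> lf a x y; apply/matrixP => i j; rewrite !mxE lf. Qed.

(** Here the square is the scalar y y^* with y = sum_s conj(xi_s) delta_s, so
no matrix cone beyond the first is involved. *)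
Lemma positive_functional_Bpos (f : X -> C^o) : positive_functional f ->
  Bpos_scalar (fun s => f (UOS_delta delta s)).
Proof.
move=> [lf pf] E admE xi.
pose a (g : G) : 'M[C]_1 := oapp (fun s : E => const_mx (xi s 0 0)^* ) 0 (insub g).
have aE (s : E) : a (val s) = const_mx (xi s 0 0)^* by rewrite /a valK.
have x_cone := square_cone hdelta D1 a admE.
have := pf (square_mx delta D E a 0 0).
have -> : const_mx (square_mx delta D E a 0 0) = square_mx delta D E a.
  by apply/matrixP => i j; rewrite !ord1 !mxE.
move=> /(_ x_cone).
have lphi := const_mx_linear lf.
have := hform_square E a (fun _ : 'I_1 => const_mx 1 : 'cV[C]_1) lphi.
rewrite !big_ord1 => sqE.
have -> : f (square_mx delta D E a 0 0) =
    (hform (const_mx 1 : 'cV[C]_1)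
      (const_mx (f (square_mx delta D E a 0 0))) (const_mx 1)) 0 0.
  by rewrite hform11.
rewrite sqE; congr (0 <= fun_of_matrix _ 0 0).
have aE' (s : E) : \sum_i (a (val s) i 0)^* *: (const_mx 1 : 'cV[C]_1) = xi s.
  by rewrite big_ord1 aE; apply/matrixP => i j; rewrite !ord1 !mxE conjCK mulr1.
apply: eq_bigr => s _; apply: eq_bigr => t _.
by rewrite !aE' /= -(zero_ext_lin _ lphi).
Qed.

Lemma UOS_spanP (x : X) : exists r : seq (C * D),
  x = \sum_(p <- r) p.1 *: UOS_delta delta p.2.
Proof.
have [n [c [y [yD xE]]]] := span_typeP x.
have /choice[d dE] (i : 'I_n) : exists s : D, y i = delta (val s).
  by have [g Dg <-] := yD i; exists (SigSub (mem_set Dg)).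
exists [seq (c i, d i) | i <- index_enum 'I_n]; apply: val_inj.
by rewrite /= span_val_sum xE big_map; apply: eq_bigr => i _; rewrite dE.
Qed.

(** The right-hand side depends only on the element of A that r represents:
this makes the linear extension of u well defined. *)
Lemma delta_comb_coef (coef : G -> A -> C) (r : seq (C * D)) (E : seq D) (u : D -> C) :
  (forall g c a b, coef g (c *: a + b) = c * coef g a + coef g b) ->
  (forall g s, coef g (delta s) = (s == g)%:R) ->
  uniq E -> {subset [seq p.2 | p <- r] <= E} ->
  \sum_(p <- r) p.1 * u p.2 =
  \sum_(s <- E) coef (val s) (\sum_(p <- r) p.1 *: delta (val p.2)) * u s.
Proof.
move=> coef_lin coefE uE rE.
have cl (s : D) : coef (val s) (\sum_(p <- r) p.1 *: delta (val p.2)) =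
    \sum_(p <- r) p.1 * (p.2 == s)%:R.
  rewrite (@linear_comb _ A C^o (coef (val s))); last exact: coef_lin.
  by apply: eq_bigr => p _; rewrite coefE.
under [RHS]eq_bigr do rewrite cl mulr_suml.
rewrite exchange_big /= big_seq [RHS]big_seq; apply: eq_bigr => p pr.
rewrite (bigD1_seq p.2) //=; last by apply: rE; exact: map_f.
rewrite eqxx mulr1 big1 ?addr0 // => s /negPf sp.
by rewrite eq_sym sp mulr0 mul0r.
Qed.

Lemma delta_comb_unique (r r' : seq (C * D)) (u : D -> C) :
  \sum_(p <- r) p.1 *: UOS_delta delta p.2 = \sum_(p <- r') p.1 *: UOS_delta delta p.2 ->
  \sum_(p <- r) p.1 * u p.2 = \sum_(p <- r') p.1 * u p.2.
Proof.
have [coef [coef_lin coefE]] := delta_coef hdelta.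
move=> /(congr1 (@span_val _ _ _)); rewrite !span_val_sum /= => rr'.
pose E := undup [seq p.2 | p <- r ++ r'].
rewrite !(delta_comb_coef (E := E) u coef_lin coefE) ?undup_uniq //.
- by rewrite rr'.
- by move=> s; rewrite mem_undup map_cat mem_cat => ->; rewrite orbT.
- by move=> s; rewrite mem_undup map_cat mem_cat => ->.
Qed.

(** The linear extension of delta_s |-> u s. The combination r that represents
x is not unique as a list; by [delta_comb_unique] the value does not depend on
it. *)
Definition delta_ext (u : D -> C) (x : X) : C^o :=
  xget 0 [set l | exists2 r : seq (C * D),
    x = \sum_(p <- r) p.1 *: UOS_delta delta p.2 & l = \sum_(p <- r) p.1 * u p.2].

Lemma delta_extE u (r : seq (C * D)) :
  delta_ext u (\sum_(p <- r) p.1 *: UOS_delta delta p.2) = \sum_(p <- r) p.1 * u p.2.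
Proof.
rewrite /delta_ext; case: xgetP => [l _ [r' rr' ->]|/(_ (\sum_(p <- r) p.1 * u p.2))[]].
  exact/esym/delta_comb_unique.
by exists r.
Qed.

Lemma delta_ext_delta u s : delta_ext u (UOS_delta delta s) = u s.
Proof. by have := delta_extE u [:: (1, s)]; rewrite !big_seq1 scale1r mul1r. Qed.

Lemma delta_ext_linear u : linear (delta_ext u).
Proof.
move=> a x y; have [r ->] := UOS_spanP x; have [r' ->] := UOS_spanP y.
have -> : a *: \sum_(p <- r) p.1 *: UOS_delta delta p.2 +
    \sum_(p <- r') p.1 *: UOS_delta delta p.2 =
    \sum_(p <- [seq (a * p.1, p.2) | p <- r] ++ r') p.1 *: UOS_delta delta p.2.
  rewrite big_cat big_map scaler_sumr; congr (_ + _).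
  by apply: eq_bigr => p _; rewrite scalerA.
rewrite !delta_extE big_cat big_map; congr (_ + _).
by rewrite scaler_sumr; apply: eq_bigr => p _; rewrite -mulrA.
Qed.

Lemma UOS_linear_ext (V : lmodType C) (f h : X -> V) : linear f -> linear h ->
  (forall s, f (UOS_delta delta s) = h (UOS_delta delta s)) -> f = h.
Proof.
move=> lf lh fh; apply/funext => x; have [r ->] := UOS_spanP x.
by rewrite (linear_comb _ _ _ lf) (linear_comb _ _ _ lh); apply: eq_bigr => p _; rewrite fh.
Qed.

(** The case n = 1 of [Bpos_cp], read at the first matrix level. *)
Lemma delta_ext_positive u : Bpos_scalar u -> positive_functional (delta_ext u).
Proof.
move=> u_pos; split=> [|x x_cone]; first exact: delta_ext_linear.
have lphi := const_mx_linear (delta_ext_linear u).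
have [|_ /(_ 1%N _ x_cone)] := Bpos_cp hdelta D1 lphi.
  move: u_pos; rewrite /Bpos_scalar /=; congr Bpos; apply/funext => s.
  by rewrite delta_ext_delta.
move=> /(_ (fun=> const_mx 1)); rewrite !big_ord1 -/(hform _ _ _).
by rewrite hform11 !mxE.
Qed.

Lemma delta_ext_comb (I : Type) (r : seq I) (c : I -> C) (u : I -> D -> C^o) :
  delta_ext (\sum_(i <- r) c i *: u i) = \sum_(i <- r) c i *: delta_ext (u i).
Proof.
apply: UOS_linear_ext.
- exact: delta_ext_linear.
- move=> a x y; rewrite !fct_sumE scaler_sumr -big_split; apply: eq_bigr => i _ /=.
  rewrite -[LHS]/(c i *: delta_ext (u i) (a *: x + y)) delta_ext_linear scalerDr.
  by congr (_ + _); rewrite !scalerA mulrC.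
- move=> s; rewrite delta_ext_delta !fct_sumE; apply: eq_bigr => i _.
  by rewrite -[RHS]/(c i *: delta_ext (u i) (UOS_delta delta s)) delta_ext_delta.
Qed.

Lemma functional_linear f : lin_span (@positive_functional R X) f -> linear f.
Proof.
move=> [n [c [x [xP ->]]]] a y z.
rewrite !fct_sumE scaler_sumr -big_split; apply: eq_bigr => i _ /=.
have [lx _] := xP i.
rewrite -[LHS]/(c i *: x i (a *: y + z)) lx scalerDr.
by congr (_ + _); rewrite !scalerA mulrC.
Qed.

End Converse.

(** * Matrix-valued positive definite functions *)

Section Bvec.
Variables (R : realType) (G : groupType) (D : set G).
Local Notation C := R[i].

Lemma zero_ext_const (u : D -> C) g :
  zero_ext (fun s => const_mx (u s) : 'M[C]_1) g = const_mx (oapp u 0 (insub g)).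
Proof. by rewrite /zero_ext; case: (insub g) => //=; rewrite const_mx0. Qed.

(** With eta_s = v^* xi_s, the form of f v v^* at xi is the form of f at eta. *)
Lemma Bpos_outer n (f : D -> C^o) (v : 'cV[C]_n) : Bpos_scalar f ->
  Bpos (fun s => f s *: (v *m map_mx Num.conj v^T)).
Proof.
move=> fpos E admE xi.
pose eta (s : E) : 'cV[C]_1 := map_mx Num.conj v^T *m xi s.
have := fpos E admE eta; congr (0 <= fun_of_matrix _ 0 0).
apply: eq_bigr => s _; apply: eq_bigr => t _.
rewrite -!/(hform _ _ _) zero_ext_const.
have -> : zero_ext (fun s => f s *: (v *m map_mx Num.conj v^T)) (val s * (val t)^-1)%g =
    (oapp f 0 (insub (val s * (val t)^-1)%g) : C) *: (v *m map_mx Num.conj v^T).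
  by rewrite /zero_ext; case: (insub _) => //=; rewrite scale0r.
move: (oapp f 0 _ : C) => z.
rewrite hform1 (linear_scale _ _ (hform_linear _ _)) hform_outer.
by apply/matrixP => i j; rewrite !mxE [in RHS]mulrA [z * _]mulrC.
Qed.

(** The form of v^* u v at the scalars xi_s is the form of u at the vectors
xi_s v. *)
Lemma Bpos_compress n (u : D -> 'M[C]_n) (v : 'cV[C]_n) : Bpos u ->
  Bpos_scalar (fun s => hform v (u s) v 0 0).
Proof.
move=> upos E admE xi.
pose eta (s : E) : 'cV[C]_n := xi s 0 0 *: v.
have := upos E admE eta; congr (0 <= fun_of_matrix _ 0 0).
apply: eq_bigr => s _; apply: eq_bigr => t _.
rewrite -!/(hform _ _ _) zero_ext_const.
have -> : (oapp (fun s => hform v (u s) v 0 0) 0 (insub (val s * (val t)^-1)%g) : C)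
  = hform v (zero_ext u (val s * (val t)^-1)%g) v 0 0.
  rewrite /zero_ext; case: (insub _) => //=.
  by rewrite /hform mulmx0 mul0mx mxE.
rewrite hform1 mxE (linear_scale _ _ (hform_linr _ _)).
rewrite hform_scalel.
by apply/matrixP => i j; rewrite !ord1 !mxE mulrC -mulrA.
Qed.

(** Since E_pq = e_p e_q^*, polarization in v and w of f v w^* reduces this to
[Bpos_outer]. *)
Lemma Bvec_entry n (f : D -> C^o) (p q : 'I_n) : lin_span (@Bpos_scalar R G D) f ->
  Bvec (fun s => f s *: delta_mx p q : 'M[C]_n).
Proof.
move=> [N [c [x [xpos ->]]]].
have -> : (fun s => (\sum_i c i *: x i) s *: delta_mx p q : 'M[C]_n) =
    \sum_i c i *: (fun s => x i s *: delta_mx p q : 'M[C]_n).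
  apply/funext => s; rewrite !fct_sumE scaler_suml; apply: eq_bigr => i _.
  by rewrite -[RHS]/(c i *: (x i s *: _)) scalerA.
apply: lin_span_sum => i; move: (x i) (xpos i) => g gpos.
pose B (v w : 'cV[C]_n) : D -> 'M[C]_n := fun s => g s *: (v *m map_mx Num.conj w^T).
have -> : (fun s => g s *: delta_mx p q : 'M[C]_n) = B (delta_mx p 0) (delta_mx q 0).
  apply/funext => s; rewrite /B trmx_delta map_delta_mx mul_delta_mx; congr (_ *: _).
rewrite (@polarization _ _ _ B).
- by apply: lin_span_sum => k; apply: lin_span_gen; exact: Bpos_outer.
- move=> a v v' w; apply/funext => s; rewrite /B mulmxDl -scalemxAl scalerDr.
  by rewrite -[RHS]/(a *: (g s *: _) + _) !scalerA [a * _]mulrC.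
- move=> a v w w'; apply/funext => s.
  rewrite /B [(_ + _)^T]linearD /= [(a *: w)^T]linearZ /=.
  rewrite map_mxD map_mxZ mulmxDr -scalemxAr scalerDr.
  by rewrite -[RHS]/(a^* *: (g s *: _) + _) !scalerA [a^* * _]mulrC.
Qed.

Lemma Bvec_mxfun n (U : 'M[Bspace R D]_n) : Bvec (mxfun U).
Proof.
have -> : mxfun U = \sum_(i < n) 1 *: \sum_(j < n)
    1 *: (fun s => span_val (U i j) s *: delta_mx i j : 'M[C]_n).
  apply/funext => s; rewrite {1}[mxfun U s]matrix_sum_delta fct_sumE.
  apply: eq_bigr => i _; rewrite scale1r fct_sumE; apply: eq_bigr => j _.
  by rewrite scale1r mxE.
apply: lin_span_sum => i; apply: lin_span_sum => j.
by apply: Bvec_entry; exact: span_typeP.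
Qed.

(** Since u_pq = e_p^* u e_q, polarization in v and w of v^* u w reduces this
to [Bpos_compress]. *)
Lemma Bvec_coord n (u : D -> 'M[C]_n) (p q : 'I_n) : Bvec u ->
  lin_span (@Bpos_scalar R G D) (fun s => u s p q : C^o).
Proof.
move=> [N [c [x [xpos ->]]]].
have -> : (fun s => (\sum_i c i *: x i) s p q : C^o) =
    \sum_i c i *: (fun s => x i s p q : C^o).
  apply/funext => s; rewrite !fct_sumE summxE; apply: eq_bigr => i _.
  by rewrite -[LHS]/((c i *: x i s) p q) mxE.
apply: lin_span_sum => i; move: (x i) (xpos i) => g gpos.
pose B (w v : 'cV[C]_n) : D -> C^o := fun s => hform v (g s) w 0 0.
have -> : (fun s => g s p q : C^o) = B (delta_mx q 0) (delta_mx p 0).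
  apply/funext => s; rewrite /B /hform trmx_delta map_delta_mx -rowE -colE.
  by rewrite !mxE.
rewrite (@polarization _ _ _ B).
- by apply: lin_span_sum => k; apply: lin_span_gen; exact: Bpos_compress.
- move=> a v v' w; apply/funext => s.
  rewrite -[RHS]/(a * B v w s + B v' w s) /B (hform_linr w (g s) a v v') mxE.
  by congr (_ + _); rewrite mxE.
- move=> a v w w'; apply/funext => s.
  rewrite -[RHS]/(a^* * B v w s + B v w' s) /B (hform_linl a w w' (g s) v) mxE.
  by congr (_ + _); rewrite mxE.
Qed.

Lemma range_mxfun n : range (fun U : 'M[Bspace R D]_n => mxfun U) = @Bvec R G D n.
Proof.
apply/seteqP; split=> [_ [U _ <-]|u uB]; first exact: Bvec_mxfun.
exists (\matrix_(p, q) Span (mem_set (Bvec_coord p q uB))) => //.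
by apply/funext => s; apply/matrixP => p q; rewrite !mxE.
Qed.

End Bvec.

(** * The duality *)

Section Duality.
Variables (R : realType) (G : groupType) (A : cstarAlg R) (delta : G -> A).
Hypothesis hdelta : is_group_cstar delta.
Variable D : set G.
Hypothesis D1 : D 1%g.
Local Notation C := R[i].
Local Notation X := (UOS D delta).

Lemma delta_ext_dual (u : Bspace R D) :
  lin_span (@positive_functional R X) (delta_ext (span_val u)).
Proof.
have [n [c [x [xpos ->]]]] := span_typeP u.
rewrite delta_ext_comb //; apply: lin_span_sum => i; apply: lin_span_gen.
exact: delta_ext_positive.
Qed.

Definition dual_map (u : Bspace R D) : mo_dual X := Span (mem_set (delta_ext_dual u)).

Lemma dual_map_linear : linear dual_map.
Proof.
move=> a u v; apply: val_inj => /=; apply: UOS_linear_ext.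
- exact: delta_ext_linear.
- move=> b x y.
  have h := functional_linear (delta_ext_dual u).
  have h' := functional_linear (delta_ext_dual v).
  rewrite -[LHS]/(a *: delta_ext (span_val u) (b *: x + y) +
    delta_ext (span_val v) (b *: x + y)).
  rewrite h h' !scalerDr !scalerA addrACA [a * b]mulrC //.
- move=> s; rewrite delta_ext_delta //.
  by rewrite -[RHS]/(a *: delta_ext (span_val u) (UOS_delta delta s) +
    delta_ext (span_val v) (UOS_delta delta s)) !delta_ext_delta.
Qed.

HB.instance Definition _ := GRing.isLinear.Build C (Bspace R D) (mo_dual X) *:%R
  dual_map dual_map_linear.

(** Makes restriction to the delta_s a map from the dual to B(D), the inverse
of [dual_map]. *)
Lemma restrict_dual (f : mo_dual X) :
  lin_span (@Bpos_scalar R G D) (fun s => span_val f (UOS_delta delta s)).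
Proof.
have [n [c [x [xpos ->]]]] := span_typeP f.
have -> : (fun s => (\sum_i c i *: x i) (UOS_delta delta s)) =
    \sum_i c i *: (fun s => x i (UOS_delta delta s) : C^o).
  by apply/funext => s; rewrite !fct_sumE.
apply: lin_span_sum => i; apply: lin_span_gen.
exact: positive_functional_Bpos.
Qed.

Definition dual_inv (f : mo_dual X) : Bspace R D := Span (mem_set (restrict_dual f)).

Lemma dual_map_delta u s : span_val (dual_map u) (UOS_delta delta s) = span_val u s.
Proof. exact: delta_ext_delta. Qed.

Lemma dual_mapK : cancel dual_map dual_inv.
Proof. by move=> u; apply/val_inj/funext => s; exact: dual_map_delta. Qed.

Lemma dual_invK : cancel dual_inv dual_map.
Proof.
move=> f; apply: val_inj; apply: (UOS_linear_ext).
- exact: delta_ext_linear.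
- exact: functional_linear (span_typeP f).
- by move=> s; exact: dual_map_delta.
Qed.

Lemma mxfun_dual_linear n (F : 'M[mo_dual X]_n) : linear (mxfun F).
Proof.
move=> a x y; apply/matrixP => i j; rewrite !mxE.
exact: (functional_linear (span_typeP (F i j))).
Qed.

Lemma mxfun_dual_map n (U : 'M[Bspace R D]_n) s :
  mxfun (map_mx dual_map U) (UOS_delta delta s) = mxfun U s.
Proof. by apply/matrixP => i j; rewrite !mxE dual_map_delta. Qed.

Lemma dual_cone n (U : 'M[Bspace R D]_n) :
  mo_cone U <-> mo_cone (map_mx dual_map U).
Proof.
have e : (fun s => mxfun (map_mx dual_map U) (UOS_delta delta s)) = mxfun U.
  by apply/funext => s; exact: mxfun_dual_map.
rewrite /= -e; split; last exact: cp_Bpos.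
by apply: Bpos_cp => //; exact: mxfun_dual_linear.
Qed.

End Duality.

Theorem corollary5p16 (R : realType) (G : groupType)
    (A : cstarAlg R) (delta : G -> A) (hdelta : is_group_cstar delta)
    (D : set G) (hD : positivity_domain D) :
  exists Phi : {linear Bspace R D -> mo_dual (UOS D delta)},
    bijective Phi /\
    forall n,
      [/\ (range (fun U : 'M[Bspace R D]_n => mxfun U) = @Bvec R G D n),
          (forall (U : 'M[Bspace R D]_n) (s : D),
             mxfun (map_mx Phi U) (UOS_delta delta s) = mxfun U s),
          [set map_mx Phi U | U in @mo_cone R (Bspace R D) n]
            = @mo_cone R (mo_dual (UOS D delta)) n
        & [set mxfun F | F in @mo_cone R (mo_dual (UOS D delta)) n]
            = @completely_positive R (UOS D delta) n].
Proof.
have [D1 _] := hD.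
exists (dual_map hdelta D1).
split; first by exists (dual_inv hdelta D1); [exact: dual_mapK|exact: dual_invK].
move=> n; split.
- exact: range_mxfun.
- exact: mxfun_dual_map.
- apply/seteqP; split=> [_ [U cU <-]|F cF]; first exact/dual_cone.
  have e : map_mx (dual_map hdelta D1) (map_mx (dual_inv hdelta D1) F) = F.
    by apply/matrixP => i j; rewrite !mxE dual_invK.
  by exists (map_mx (dual_inv hdelta D1) F) => //; apply/(dual_cone hdelta D1); rewrite e.
- apply/seteqP; split=> [_ [F cF <-] //|phi cphi].
  (* phi is recovered from its values at the delta_s, which lie in B(D, C^n)+ *)
  have : range (fun U : 'M[Bspace R D]_n => mxfun U)
      (fun s => phi (UOS_delta delta s)).
    by rewrite range_mxfun; apply: lin_span_gen; exact: cp_Bpos.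
  move=> [U _ Uphi]; have e : mxfun (map_mx (dual_map hdelta D1) U) = phi.
    apply: UOS_linear_ext; [exact: mxfun_dual_linear|exact: cphi.1|].
    by move=> s; rewrite mxfun_dual_map Uphi.
  by exists (map_mx (dual_map hdelta D1) U) => //; rewrite /= e.
Qed.
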